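(* Let $A$ be a finite skew left brace of nilpotent type and let $p$ be a prime number. The following statements are equivalent: (1) $A$ is left $p$-nilpotent. (2) $A_{p'}*A_p=0$. (3) The group $(A,\circ)$ is $p$-nilpotent.
   Context: A skew left brace is a triple $(A,+,\circ)$, where $(A,+)$ and $(A,\circ)$ are (not necessarily abelian) groups such that $a\circ(b+c)=a\circ b-a+a\circ c$ for all $a,b,c\in A$. It is of nilpotent type if $(A,+)$ is a nilpotent group. Write $\lambda_a(b)=-a+a\circ b$ and $a*b=\lambda_a(b)-b$. For subsets $X,Y\subseteq A$, $X*Y$ is the subgroup of $(A,+)$ generated by all $x*y$ with $x\in X$, $y\in Y$. For a finite skew left brace $A$ of nilpotent type, $A_p$ denotes the Sylow $p$-subgroup of $(A,+)$, and $A_{p'}=\sum_{q\neq p}A_q$, the sum over the prime divisors $q\ne p$ of $|A|$, is the Hall $p'$-subgroup of $(A,+)$. For subsets $X,Y$ of $A$ define $L_0(X,Y)=Y$ and $L_{n+1}(X,Y)=X*L_n(X,Y)$ for $n\geq0$. A finite skew left brace $A$ of nilpotent type is left $p$-nilpotent if there exists $n\geq1$ such that $L_n(A,A_p)=0$. A finite group $G$ is $p$-nilpotent if it has a normal Hall $p'$-subgroup, i.e. a normal subgroup of order $m$ where $|G|=p^km$ and $p\nmid m$. *)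

(* Defs.v *)
From HB Require Import structures.
From mathcomp Require Import all_boot all_fingroup all_solvable.

Set Implicit Arguments.
Unset Strict Implicit.
Unset Printing Implicit Defensive.

Local Open Scope group_scope.

(* The additive group (A, +) of a skew left brace need not be abelian, so it
   is the group structure of A itself, in multiplicative notation:
     a + b  is  a * b,      -a  is  a^-1,      0  is  1.
   The neutral element of the second operation is a separate field: that it
   coincides with 1 is a consequence of the axioms. *)
HB.mixin Record isSkewLeftBrace A of monoid.Group A := {
  circ : A -> A -> A;
  circ_one : A;
  circ_inv : A -> A;
  circA : associative circ;
  circ1b : left_id circ_one circ;
  circVb : left_inverse circ_one circ_inv circ;
  circMr : forall a b c : A, circ a (b * c) = circ a b * a^-1 * circ a c
}.

#[short(type="skewLeftBraceType")]
HB.structure Definition SkewLeftBrace := { A of isSkewLeftBrace A & monoid.Group A }.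

#[short(type="finSkewLeftBraceType")]
HB.structure Definition FinSkewLeftBrace :=
  { A of isSkewLeftBrace A & FinGroup A }.

(* Copy of A whose group structure is (A, circ). *)
Definition circ_group (A : Type) : Type := A.

HB.instance Definition _ (A : finSkewLeftBraceType) :=
  Finite.copy (circ_group A) A.
HB.instance Definition _ (A : finSkewLeftBraceType) :=
  Finite_isGroup.Build (circ_group A)
    (@circA A) (@circ1b A) (@circVb A).

Lemma circ_groupM (A : finSkewLeftBraceType) (x y : circ_group A) :
  x * y = circ (x : A) (y : A).
Proof. by []. Qed.

Definition brace_lambda (A : skewLeftBraceType) (a b : A) : A :=
  a^-1 * circ a b.

Definition brace_star (A : skewLeftBraceType) (a b : A) : A :=
  brace_lambda a b * b^-1.

Section FiniteBraces.

Variable A : finSkewLeftBraceType.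

Definition nilpotent_type : bool := nilpotent [set: A].

Definition star_set (X Y : {set A}) : {set A} :=
  <<[set brace_star x y | x in X, y in Y]>>.

Fixpoint brace_L (n : nat) (X Y : {set A}) : {set A} :=
  if n is n'.+1 then star_set X (brace_L n' X Y) else Y.

(* Meaningful for A of nilpotent type, where the Sylow p-subgroup of (A, +) is
   unique; see brace_SylowE. *)
Definition brace_Sylow (p : nat) : {group A} :=
  sval (Sylow_exists p [set: A]%G).

(* The product of sets is the sum of subsets of (A, +). *)
Definition brace_Hall' (p : nat) : {set A} :=
  \prod_(q <- primes #|A| | q != p) brace_Sylow q.

Definition left_p_nilpotent (p : nat) : Prop :=
  exists2 n : nat, 1 <= n & brace_L n [set: A] (brace_Sylow p) = 1.

End FiniteBraces.

Arguments nilpotent_type : clear implicits.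
Arguments brace_Sylow : clear implicits.
Arguments brace_Hall' : clear implicits.
Arguments left_p_nilpotent : clear implicits.

Definition p_nilpotent (p : nat) (gT : finGroupType) (G : {group gT}) : Prop :=
  exists2 N : {group gT}, N <| G & p^'.-Hall(G) N.

Lemma brace_SylowP (A : finSkewLeftBraceType) (p : nat) :
  p.-Sylow([set: A]) (brace_Sylow A p).
Proof. exact: svalP (Sylow_exists p [set: A]%G). Qed.

Lemma brace_SylowE (A : finSkewLeftBraceType) (p : nat) (P : {group A}) :
  nilpotent_type A -> p.-Sylow([set: A]) P -> P = brace_Sylow A p.
Proof.
move=> nilA sylP; apply/val_inj => /=.
by rewrite (nilpotent_Hall_pcore nilA sylP)
           (nilpotent_Hall_pcore nilA (brace_SylowP A p)).
Qed.

Lemma brace_Hall'P (A : finSkewLeftBraceType) (p : nat) :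
  nilpotent_type A -> brace_Hall' A p = 'O_p^'([set: A]).
Proof.
move=> nilA.
have SE q : brace_Sylow A q = 'O_q([set: A]) :> {set A}.
  exact: nilpotent_Hall_pcore nilA (brace_SylowP A q).
have prodE (r : seq nat) : uniq r ->
    \prod_(q <- r) brace_Sylow A q = 'O_[pred q in r]([set: A]).
  elim: r => [_ | q r IHr /= /andP[r'q uniq_r]].
    rewrite big_nil; apply/esym/eqP; rewrite trivg_card1; apply/eqP.
    apply: pnat_1 (pcore_pgroup _ _) _; apply/pnatP => //.
  rewrite big_cons (IHr uniq_r) SE.
  set K := 'O_[pred x in q :: r]([set: A]).
  have nilK : nilpotent K by apply: nilpotentS nilA; apply: subsetT.
  have [_ defK _ _] := dprodP (nilpotent_pcoreC q nilK).
  apply: etrans defK; rewrite -!(pcoreI _ _ [set: A]%G); congr (_ * _).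
    by apply: eq_pcore => x; rewrite !inE; case: (x =P q); rewrite ?orbT ?andbF.
  apply: eq_pcore => x; rewrite !inE.
  by case: (x =P q) => [->|]; rewrite ?(negPf r'q).
rewrite /brace_Hall' -big_filter prodE ?filter_uniq ?primes_uniq //.
apply: eq_in_pcore => x piA_x; rewrite !inE mem_filter -cardsT.
by rewrite piA_x andbT.
Qed.

(* Main.v *)
Require Import Defs.
From mathcomp Require Import all_boot all_fingroup all_solvable.

(** Let P and K be the Sylow p-subgroup and the Hall p'-subgroup of (A, +).
As (A, +) is nilpotent, it is the direct product of P and K, and both factors
are characteristic.  The map lambda is an action of (A, circ) on (A, +) by
automorphisms, so it stabilises P and K; since a circ b = a + lambda_a(b), both
are also subgroups of (A, circ), and every element is h circ k with h in P and
k in K.  The condition K * P = 0 says that lambda makes K act trivially on P.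

K * P = 0 iff (A, circ) is p-nilpotent.  K is a Hall p'-subgroup of (A, circ),
so p-nilpotency means that K is normal in (A, circ).  If K fixes P pointwise,
then h circ b = lambda_h(b) circ h for h in P and b in K, because P and K
commute in (A, +); hence P normalises K.  Conversely, if K is normal, then
b circ c = a circ b for a in K, b in P and some c in K; comparing components in
the direct sum of P and K gives lambda_a(b) = b [star_set1_normal].

K * P = 0 iff A is left p-nilpotent.  In the holomorph, the semidirect product
of (A, +) by (A, circ) for lambda, star products become commutators
[morphim_star_set].  If L_n(A, P) = 0, then the iterated commutators
[P, K, ..., K] are eventually trivial; the action of K on P being coprime,
[P, K, K] = [P, K], so [P, K] = 1 [left_nilpotent_fix].  If K acts trivially on
P, then L_n(A, P) = L_n(P, P), and this lies in a term of the lower central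
series of the semidirect product of (P, +) by (P, circ), which is a p-group and
so nilpotent [fix_left_nilpotent]. *)

Set Implicit Arguments.
Unset Strict Implicit.
Unset Printing Implicit Defensive.
Local Open Scope group_scope.

(** * Coprime action *)

(** Since A centralises G / [G, A] and fixed points lift along quotients under
coprime action, G = [G, A] 'C_G(A); the second factor contributes nothing to
[G, A]. *)
Lemma coprime_commg_idem (gT : finGroupType) (A G : {group gT}) :
  A \subset 'N(G) -> coprime #|G| #|A| -> solvable G ->
  [~: G, A, A] = [~: G, A].
Proof.
move=> nGA coGA solG; set R := [~: G, A].
have sRG : R \subset G by rewrite commg_subl.
have nRA : A \subset 'N(R) by apply: commg_normr.
have nRG : G \subset 'N(R) by apply: commg_norml.
(* A acts trivially on G / R, so fixed points of G cover G / R. *)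
have sG_RC : G \subset R * 'C_G(A).
  have solR := solvableS sRG solG.
  rewrite -quotientSK // coprime_norm_quotient_cent ?(coprimeSg sRG) //.
  by rewrite subsetI subxx quotient_cents2r.
have nRA_C : 'C_G(A) \subset 'N([~: R, A]).
  apply: normsR; first exact: subset_trans (subsetIl _ _) nRG.
  exact: subset_trans (subsetIr _ _) (cent_sub A).
apply/eqP; rewrite eqEsubset commg_subl nRA /=.
rewrite (subset_trans (commSg A sG_RC)) // commMG //.
by rewrite (commG1P (subsetIr _ _)) mulg1.
Qed.

(** * The lambda action *)

Section BraceLambda.

Variable A : finSkewLeftBraceType.
Implicit Types (a b c : A) (x y : circ_group A).

Lemma circ_add_lambda a b : circ a b = a * brace_lambda a b.
Proof. by rewrite /brace_lambda mulKVg. Qed.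

(** From a circ 0 = a circ (0 + 0) = a circ 0 - a + a circ 0 one gets
a circ 0 = a, so that 0 is a right neutral element for circ. *)
Lemma circ_neutral : (1 : circ_group A) = (1 : A).
Proof.
have circ1 a : circ a 1 = a.
  by apply: (mulgI (circ a 1 * a^-1)); rewrite -circMr mulg1 mulgKV.
by rewrite -[LHS]circ1; apply: circ1b.
Qed.

Lemma brace_lambdaM a : {morph brace_lambda a : b c / b * c}.
Proof. by move=> b c; rewrite /brace_lambda circMr !mulgA. Qed.

Lemma brace_lambda_circ a b c :
  brace_lambda (circ a b) c = brace_lambda a (brace_lambda b c).
Proof.
apply: (mulgI (circ a b)).
by rewrite -circ_add_lambda -circA (circ_add_lambda b) circMr -mulgA.
Qed.

Lemma brace_lambda_neutral b : brace_lambda (1 : circ_group A) b = b.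
Proof. by rewrite /brace_lambda [circ _ _]circ1b circ_neutral invg1 mul1g. Qed.

Lemma brace_lambdaK x : cancel (brace_lambda x) (brace_lambda (x^-1)).
Proof.
by move=> b; rewrite -brace_lambda_circ -circ_groupM mulVg brace_lambda_neutral.
Qed.

Lemma brace_lambdaVK x : cancel (brace_lambda (x^-1)) (brace_lambda x).
Proof. by move=> b; rewrite -{1}[x]invgK brace_lambdaK. Qed.

Lemma brace_star1P a b : reflect (brace_lambda a b = b) (brace_star a b == 1).
Proof. by rewrite -eq_mulgV1; apply: eqP. Qed.

Lemma star_set1P (X Y : {set A}) :
  star_set X Y = 1 <-> {in X & Y, forall a b, brace_lambda a b = b}.
Proof.
split=> [XY1 a b Xa Yb | fixXY].
  apply/brace_star1P; rewrite -in_set1 -[[set 1]]XY1.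
  by apply/mem_gen/imset2P; exists a b.
apply/trivgP; rewrite gen_subG; apply/subsetP=> _ /imset2P[a b Xa Yb ->].
by rewrite inE; apply/brace_star1P/fixXY.
Qed.

(** Actions are right actions here, while lambda is a left action; hence the
inverse. *)
Definition lambda_op b x : A := brace_lambda (x^-1) b.

Lemma lambda_op_is_action : is_action [set: circ_group A] lambda_op.
Proof.
apply: is_total_action => [b | b x y].
  by rewrite /lambda_op invg1 brace_lambda_neutral.
by rewrite /lambda_op invMg brace_lambda_circ.
Qed.

Canonical lambda_action := Action lambda_op_is_action.

Lemma lambda_is_groupAction : is_groupAction [set: A] lambda_action.
Proof.
move=> x _; rewrite inE; apply/andP; split.
  by apply/subsetP=> ? _; rewrite inE.
by apply/morphicP => b c _ _; rewrite !actpermE /= /lambda_op brace_lambdaM.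
Qed.

Canonical lambda_groupAction := GroupAction lambda_is_groupAction.

Lemma brace_lambda_char (H : {group A}) a b :
  H \char [set: A] -> b \in H -> brace_lambda a b \in H.
Proof.
move=> chH Hb.
have /acts_act actH := acts_char lambda_groupAction (subxx _) chH.
have := actH ((a : circ_group A)^-1) (in_setT _) b.
by rewrite /= /lambda_op invgK => ->.
Qed.

(** As circ a b = a * brace_lambda a b, a subgroup of (A, +) stable under lambda
is closed under circ. *)
Lemma circ_group_set (H : {group A}) :
  H \char [set: A] -> group_set (H : {set circ_group A}).
Proof.
move=> chH; apply/group_setP; split=> [|a b Ha Hb].
  by rewrite circ_neutral; apply: (group1 H).
rewrite circ_groupM circ_add_lambda.
by apply: (groupM (G := H)); rewrite ?brace_lambda_char.
Qed.

Definition circ_subgroup (H : {group A}) (chH : H \char [set: A]) :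
  {group circ_group A} := Group (circ_group_set chH).

(** * Star products as commutators in the holomorph *)

Local Notation hol := (sdprod_by lambda_groupAction).
Local Notation iota := (sdpair1 lambda_groupAction).
Local Notation kappa := (sdpair2 lambda_groupAction).

Lemma sdpair_star x b :
  iota (brace_star x b) = [~ kappa x^-1, iota b^-1].
Proof.
rewrite /brace_star morphM ?inE // commgEr !morphV ?inE // !invgK; congr (_ * _).
by rewrite -morphV ?inE // -sdpair_act ?inE //= /lambda_op invgK.
Qed.


(** Up to inverting both arguments, brace_star x b is the commutator of x and b
in the holomorph; on subgroups the inversions disappear. *)
Lemma morphim_star_set (X : {group circ_group A}) (Y : {group A}) :
  iota @* star_set X Y = [~: kappa @* X, iota @* Y].
Proof.
rewrite morphim_gen ?subsetT //; apply/eqP; rewrite eqEsubset !gen_subG.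
apply/andP; split; apply/subsetP=> u.
  case/morphimP=> _ _ /imset2P[x b Xx Yb ->] ->.
  rewrite [sdpair1_morphism _ _](sdpair_star x b).
  by rewrite mem_commg ?mem_morphim ?inE ?groupV.
case/imset2P=> _ _ /morphimP[x _ Xx ->] /morphimP[b _ Yb ->] ->.
rewrite -[x]invgK -[b]invgK -sdpair_star.
by apply/mem_gen/mem_morphim; rewrite ?inE //; apply: imset2_f; rewrite groupV.
Qed.

Lemma star_setS (X1 X2 Y : {set A}) :
  X1 \subset X2 -> star_set X1 Y \subset star_set X2 Y.
Proof. by move=> sX12; rewrite genS ?imset2S. Qed.

Lemma brace_L_group_set n (X : {set A}) (Y : {group A}) :
  group_set (brace_L n X Y).
Proof. by case: n => [|n]; apply: groupP. Qed.

Canonical brace_L_group n X Y := Group (brace_L_group_set n X Y).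

Lemma brace_L_sub n (X : {set A}) (H : {group A}) :
  H \char [set: A] -> brace_L n X H \subset H.
Proof.
move=> chH; elim: n => //= n IHn.
rewrite gen_subG; apply/subsetP=> _ /imset2P[a b _ /(subsetP IHn) Hb ->].
by rewrite groupM ?groupV ?brace_lambda_char.
Qed.

(** * Direct decompositions into characteristic subgroups *)

Section Decomposition.

Variables H K : {group A}.
Hypotheses (chH : H \char [set: A]) (chK : K \char [set: A]).
Hypothesis defA : H \x K = [set: A].

Lemma circ_factor a : exists b c, [/\ b \in H, c \in K & a = circ b c].
Proof.
have /mulsgP[b c Hb Kc ->] : a \in H * K.
  by have [_ -> _ _] := dprodP defA; rewrite inE.
exists b, (brace_lambda ((b : circ_group A)^-1) c).
by split; rewrite ?brace_lambda_char // circ_add_lambda brace_lambdaVK.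
Qed.

(** Writing x = h circ k, the factor k moves no element of Y, so x and h have the
same star products with Y. *)
Lemma star_set_fix (Y : {set A}) :
  {in K & Y, forall a b, brace_lambda a b = b} ->
  star_set [set: A] Y = star_set H Y.
Proof.
move=> fixKY; apply/eqP.
rewrite eqEsubset [X in _ && X]star_setS ?subsetT // andbT.
rewrite genS //; apply/subsetP=> _ /imset2P[a b _ Yb ->].
have [h [k [Hh Kk ->]]] := circ_factor a.
have -> : brace_star (circ h k) b = brace_star h b.
  by rewrite /brace_star brace_lambda_circ (fixKY k b).
exact: imset2_f.
Qed.

(** Both directions compare the two ways of writing an element of H circ K as a
product of elements of H and K, using that H and K commute in (A, +). *)
Lemma star_set1_normal :
  star_set K H = 1 <-> circ_subgroup chK <| [set: circ_group A].
Proof.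
have [_ _ cHK tiHK] := dprodP defA.
apply: (iff_trans (star_set1P _ _)); split=> [fixKH | nsK a b Ka Hb].
  rewrite /normal subsetT; apply/subsetP=> x _.
  have [h [k [Hh Kk ->]]] := circ_factor x.
  have Nk : (k : circ_group A) \in 'N(circ_subgroup chK).
    exact: (subsetP (normG (circ_subgroup chK))).
  (* The inverse of h conjugates b to brace_lambda h b. *)
  rewrite -circ_groupM groupMr // -groupV inE; apply/subsetP=> _ /imsetP[b Kb ->].
  suffices -> : (b : circ_group A) ^ (h : circ_group A)^-1 = brace_lambda h b.
    exact: brace_lambda_char.
  have Klb : brace_lambda h b \in K by apply: brace_lambda_char.
  apply: (@mulIg (circ_group A) h); rewrite conjgE invgK mulgA mulgKV.
  rewrite !circ_groupM !circ_add_lambda (fixKH (brace_lambda h b) h) //.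
  exact/esym/(centsP cHK).
(* b circ c = a circ b with c in K: the components in H and K must agree. *)
have Kc : (a : circ_group A) ^ (b : circ_group A) \in circ_subgroup chK.
  by rewrite memJ_norm ?(subsetP (normal_norm nsK)) ?inE.
set c := _ ^ _ in Kc.
have def_c : b * brace_lambda b c = a * brace_lambda a b.
  by rewrite -!circ_add_lambda -!circ_groupM -conjgC.
have Klc : brace_lambda b c \in K by apply: brace_lambda_char.
have Hlb : brace_lambda a b \in H by apply: brace_lambda_char.
apply/esym/eqP; rewrite eq_mulVg1 -in_set1 -[[set 1]]tiHK inE.
rewrite groupM ?groupV //=.
have -> : b^-1 * brace_lambda a b = brace_lambda b c * a^-1.
  apply: (mulgI b); rewrite mulKVg mulgA def_c.
  by rewrite (centsP cHK a Ka) // mulgK.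
by rewrite groupM ?groupV.
Qed.

Lemma sdpair_norm_char (X : {group circ_group A}) :
  kappa @* X \subset 'N(iota @* H).
Proof. by rewrite -actsEsd ?subsetT // acts_char ?subsetT. Qed.

Lemma morphim_brace_L n :
  iota @* brace_L n H H \subset
    'L_n.+1(iota @* H <*> kappa @* circ_subgroup chH).
Proof.
elim: n => [|n IHn] /=; first by rewrite lcn1 joing_subl.
rewrite (morphim_star_set (circ_subgroup chH)) lcnSn commGC.
by rewrite commgSS // joing_subr.
Qed.

(** H and its copy in (A, circ) generate a p-group in the holomorph, whose lower
central series controls brace_L n H H; that H alone may replace all of A is
star_set_fix. *)
Lemma fix_left_nilpotent (p : nat) :
    p.-group H -> {in K & H, forall a b, brace_lambda a b = b} ->
  exists2 n, 1 <= n & brace_L n [set: A] H = 1.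
Proof.
move=> pH fixKH.
have L_H n : brace_L n [set: A] H = brace_L n H H.
  elim: n => //= n IHn; rewrite -IHn; apply: star_set_fix => a b Ka Lb.
  exact: fixKH Ka (subsetP (brace_L_sub n _ chH) _ Lb).
set G := iota @* H <*> kappa @* circ_subgroup chH.
have pG : p.-group G.
  by rewrite /G norm_joinEr ?sdpair_norm_char // pgroupM !morphim_pgroup.
have nilG : nilpotent G := pgroup_nil pG.
exists (nil_class G).+1 => //; rewrite L_H; apply/eqP.
rewrite -(morphim_injm_eq1 (injm_sdpair1 lambda_groupAction)) ?subsetT //.
rewrite -subG1 (subset_trans (morphim_brace_L _)) // subG1.
exact/eqP/(lcn_nil_classP _ nilG).
Qed.

(** By coprimality [H, K] = [H, K, ..., K] in the holomorph, with any number of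
K's, and this lies in the image of brace_L n [set: A] H for every n. *)
Lemma left_nilpotent_fix n :
    coprime #|H| #|K| -> solvable H -> brace_L n [set: A] H = 1 ->
  star_set K H = 1.
Proof.
move=> coHK solH Ln1.
set kK := kappa @* circ_subgroup chK.
have nHK : kK \subset 'N(iota @* H) by apply: sdpair_norm_char.
have idR : [~: iota @* H, kK, kK] = [~: iota @* H, kK].
  rewrite coprime_commg_idem ?morphim_sol //.
  rewrite (coprime_dvdl (dvdn_morphim _ _)) //.
  by rewrite (coprime_dvdr (dvdn_morphim _ _)).
have sRL m : [~: iota @* H, kK] \subset iota @* brace_L m [set: A] H.
  elim: m => [|m IHm]; first by rewrite commg_subl.
  rewrite -idR (subset_trans (commSg _ IHm)) // commGC.
  rewrite -(morphim_star_set (circ_subgroup chK)) /=.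
  by rewrite morphimS // star_setS ?subsetT.
apply/eqP.
rewrite -(morphim_injm_eq1 (injm_sdpair1 lambda_groupAction)) ?subsetT //.
rewrite (morphim_star_set (circ_subgroup chK)) commGC -subG1.
by rewrite (subset_trans (sRL n)) // Ln1 morphim1.
Qed.

End Decomposition.

End BraceLambda.

Theorem theorem6p4 (A : finSkewLeftBraceType) (p : nat)
    (nilA : nilpotent_type A) (p_pr : prime p) :
  (left_p_nilpotent A p <-> star_set (brace_Hall' A p) (brace_Sylow A p) = 1)
  /\ (star_set (brace_Hall' A p) (brace_Sylow A p) = 1
      <-> p_nilpotent p [set: circ_group A]%G).
Proof.
have hallP := nilpotent_pcore_Hall p nilA.
have <- : 'O_p([set: A])%G = brace_Sylow A p by apply: brace_SylowE.
rewrite /left_p_nilpotent.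
have <- : 'O_p([set: A])%G = brace_Sylow A p by apply: brace_SylowE.
rewrite brace_Hall'P //.
have chP : 'O_p([set: A])%G \char [set: A] by apply: pcore_char.
have chK : 'O_p^'([set: A])%G \char [set: A] by apply: pcore_char.
have defA := nilpotent_pcoreC p nilA.
split.
  split=> [[n _] | /star_set1P fixKP].
    apply: (left_nilpotent_fix chP chK); first exact: coprime_pcoreC.
    exact/nilpotent_sol/(nilpotentS (subsetT _)).
  exact: (fix_left_nilpotent chP chK defA (pcore_pgroup p _)).
apply: (iff_trans (star_set1_normal chP chK defA)).
have hallK : p^'.-Hall([set: circ_group A]) (circ_subgroup chK).
  have:= nilpotent_pcore_Hall p^' nilA.
  by rewrite !pHallE !subsetT.
split=> [nsK | [N nsN hallN]]; first by exists (circ_subgroup chK).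
have oN := normal_Hall_pcore hallN nsN.
by rewrite (eq_Hall_pcore _ hallK) oN.
Qed.
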